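(* Let $P$ be a connected poset such that $\check{P}$ is ranked, with rank function $\rho$. Then $\mathcal{L}(P)$ is centrally-symmetric with respect to $\rho$, i.e., $\rho - \mathcal{L}(P) = \mathcal{L}(P)$, where $\rho - \mathcal{L}(P) = \{\rho|_P - f : f \in \mathcal{L}(P)\}$.
   Context: All posets are finite. For a poset $(P,\preceq)$, $a \lessdot b$ denotes a cover relation, and $\check{P} = P \cup \{\hat 0\}$ is $P$ with a new minimum $\hat 0$ adjoined (even if $P$ already has a minimum). A poset is connected if its Hasse diagram is connected. A poset is ranked if for all elements $a,b$ all maximal chains in the interval $[a,b]$ have the same length. For $\check{P}$, which has the minimum $\hat 0$, this is equivalent to the existence of a (unique) rank function $\rho : \check{P} \to \mathbb{Z}_{\ge 0}$ with $\rho(\hat 0) = 0$ and $\rho(b) = \rho(a)+1$ whenever $a \lessdot b$ in $\check{P}$. Lipschitz polytope: $\mathcal{L}(P) \subset \mathbb{R}^P$ is the set of all $f : P \to \mathbb{R}$ with $0 \le f(a) \le 1$ for every minimal element $a$ of $P$ and $0 \le f(b)-f(a) \le 1$ for every cover relation $a \lessdot b$ in $P$. *)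

(* Defs.v *)
From HB Require Import structures.
From mathcomp Require Import all_boot all_order all_algebra.
From mathcomp Require Import classical_sets reals.
Set Implicit Arguments.
Unset Strict Implicit.
Unset Printing Implicit Defensive.
Import Order.TTheory GRing.Theory Num.Theory.
Local Open Scope order_scope.

Section Poset.
Context {d : Order.disp_t} {T : finPOrderType d}.
Implicit Types (a b : T) (A C : {set T}).

Definition covers a b : bool := (a < b) && [forall c, ~~ (a < c < b)].

Definition is_minimal a : bool := [forall b, ~~ (b < a)].

Definition hasse : rel T := [rel a b | covers a b || covers b a].

Definition is_chain C : bool := [forall a in C, forall b in C, a >=< b].

Definition max_chain A C : bool :=
  maxset [pred D : {set T} | (D \subset A) && is_chain D] C.

Definition chain_length C : nat := #|C|.-1.

End Poset.

Definition poset_connected {d} (T : finPOrderType d) : Prop :=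
  forall a b : T, connect hasse a b.

Definition ranked {d} (T : finPOrderType d) : Prop :=
  forall (a b : T) (C D : {set T}),
    max_chain [set x in `[a, b]] C -> max_chain [set x in `[a, b]] D ->
    chain_length C = chain_length D.

(* The poset obtained by adjoining a new minimum [None], even if the given
   poset already has one. *)
Definition with_min (T : Type) : Type := option T.

Section WithMin.
Context {d : Order.disp_t} {P : finPOrderType d}.

HB.instance Definition _ := Finite.on (with_min P).

Definition with_min_le (x y : with_min P) : bool :=
  match x, y with
  | None, _ => true
  | Some _, None => false
  | Some a, Some b => a <= b
  end.

Fact with_min_le_refl : reflexive with_min_le.
Proof. by case=> //= a. Qed.

Fact with_min_le_anti : antisymmetric with_min_le.
Proof. by case=> [a|] [b|] //= /le_anti ->. Qed.

Fact with_min_le_trans : transitive with_min_le.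
Proof. by case=> [b|] [a|] [c|] //=; apply: le_trans. Qed.

HB.instance Definition _ := Order.Le_isPOrder.Build d (with_min P)
  with_min_le_refl with_min_le_anti with_min_le_trans.

Fact with_min_le0 (x : with_min P) : (None : with_min P) <= x.
Proof. by []. Qed.

HB.instance Definition _ := Order.hasBottom.Build d (with_min P) with_min_le0.

End WithMin.

Definition rank_function {d} {P : finPOrderType d} (rho : with_min P -> nat) : Prop :=
  rho \bot = 0%N /\ forall x y : with_min P, covers x y -> rho y = (rho x).+1.

Definition lipschitz_polytope (R : realType) {d} (P : finPOrderType d) :
    set {ffun P -> R} :=
  [set f : {ffun P -> R} |
    (forall a, is_minimal a -> (0 <= f a <= 1)%R) /\
    (forall a b, covers a b -> (0 <= f b - f a <= 1)%R)]%classic.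

(* The restriction of rho to P, as a point of R^P. *)
Definition rank_vector (R : realType) {d} {P : finPOrderType d}
    (rho : with_min P -> nat) : {ffun P -> R} :=
  [ffun a : P => ((rho (Some a))%:R)%R].

Arguments lipschitz_polytope R {d} P.
Arguments rank_vector R {d P} rho.

(* Main.v *)
Require Import Defs.
From mathcomp Require Import all_boot all_order all_algebra.
From mathcomp Require Import classical_sets reals.
From mathcomp Require Import ring.

(** The rank function has increment 1 along every cover relation of P and value
    1 at every minimal element, so [f |-> rho - f] acts on each quantity
    constrained by the polytope as [t |-> 1 - t], which preserves [[0, 1]]. *)

Import Order.TTheory GRing.Theory Num.Theory.

Section WithMinCovers.
Context {d : Order.disp_t} {P : finPOrderType d}.
Implicit Types a b : P.

Lemma lt_with_min_Some a b :
  ((Some a : with_min P) < Some b)%O = (a < b)%O.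
Proof. by rewrite !lt_neqAle. Qed.

(** The adjoined [None] lies below [Some a], so it cannot come between [Some a] and [Some b]. *)
Lemma covers_Some a b :
  covers a b -> covers (Some a : with_min P) (Some b).
Proof.
move=> /andP[ab /forallP nob]; rewrite /covers lt_with_min_Some ab /=.
apply/forallP=> -[c|]; first by rewrite !lt_with_min_Some nob.
by rewrite lt_neqAle.
Qed.

(** Anything strictly between would be some [Some c] with [c < a]. This lets [rho] be computed at
    minimal elements from its value at the bottom. *)
Lemma covers_bot_Some a :
  is_minimal a -> covers (\bot%O : with_min P) (Some a).
Proof.
move=> /forallP min_a; rewrite /covers lt_neqAle /=.
by apply/forallP=> -[c|]; rewrite ?ltxx// lt_with_min_Some (negbTE (min_a c)) andbF.
Qed.

End WithMinCovers.

Local Open Scope ring_scope.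

Lemma subr_unit_itv (R : realType) (t : R) : (0 <= 1 - t <= 1) = (0 <= t <= 1).
Proof. by rewrite subr_ge0 lerBlDr lerDl andbC. Qed.

Lemma lipschitz_polytope_rankB (R : realType) (d : Order.disp_t)
    (P : finPOrderType d) (rho : with_min P -> nat) (f : {ffun P -> R}) :
  rank_function rho -> lipschitz_polytope R P f ->
  lipschitz_polytope R P (rank_vector R rho - f).
Proof.
move=> [rho0 rhoS] [f_min f_cov]; split=> [a min_a | a b ab]; rewrite !ffunE.
  (* Here [rho (Some a)] is 1, so the coordinate is [1 - f a]. *)
  by rewrite (rhoS _ _ (covers_bot_Some _ min_a)) rho0 subr_unit_itv f_min.
rewrite (rhoS _ _ (covers_Some _ _ ab)).
have -> : (rho (Some a)).+1%:R - f b - ((rho (Some a))%:R - f a)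
  = 1 - (f b - f a) :> R by ring.
by rewrite subr_unit_itv f_cov.
Qed.

Theorem proposition4p1 (R : realType) (d : Order.disp_t) (P : finPOrderType d)
    (rho : with_min P -> nat) (P_connected : poset_connected P)
    (P_ranked : ranked (with_min P)) (rho_rank : rank_function rho) :
  [set (rank_vector R rho - f)%R | f in lipschitz_polytope R P]%classic
  = lipschitz_polytope R P.
Proof.
apply/seteqP; split=> [_ [f f_lip <-] | f f_lip].
  exact: lipschitz_polytope_rankB.
(* The reflection is an involution, so [f] is the image of its own reflection and the reverse
   inclusion follows from the first. *)
exists (rank_vector R rho - f); first exact: lipschitz_polytope_rankB.
by rewrite subKr.
Qed.
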